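(* Define, for $t>0$ and $|x|<t$, with $z=\sqrt{t^2-x^2}$, $$g_c(t,x)=\tfrac12u^2_0(t,x)+\tfrac14\left(u^1_1(t,x)+u^3_1(t,x)+u^1_2(t,x)+u^3_2(t,x)+u^0_4(t,x)\right),$$ where $$u^0_0=\tfrac12\left(I_0(z)+J_0(z)\right),\qquad u^2_0=\tfrac12\left(I_0(z)-J_0(z)\right),$$ $$u^1_1=\frac{x}{z}\left(I_1(z)+J_1(z)\right),\qquad u^3_1=\frac{x}{z}\left(I_1(z)-J_1(z)\right),$$ $$u^1_2=\frac{t}{z}\left(I_1(z)+J_1(z)\right),\qquad u^3_2=\frac{t}{z}\left(I_1(z)-J_1(z)\right),$$ $$u^0_4=2\frac{\partial u^1_2}{\partial t}-2u^0_0,$$ and put $f_c(t,x)=e^{-t}g_c(t,x)$. Then: (i) $f_c$ satisfies, in the region $|x|<t$, the fourth-order hyperbolic equation $$\left(\frac{\partial}{\partial t}-\frac{\partial}{\partial x}+1\right)^2\left(\frac{\partial}{\partial t}+\frac{\partial}{\partial x}+1\right)^2f_c(t,x)-f_c(t,x)=0.$$ (ii) Putting $f(t,x)=f_c(t,x)+e^{-t}(1+t)\,\delta(t-x)$, where $\delta(t-x)$ denotes the unit mass at $x=t$, one has $\int_{-t}^{t}f(t,x)\,dx=1$ for all $t\ge0$, i.e. $\int_{-t}^{t}f_c(t,x)\,dx+e^{-t}(1+t)=1$. (iii) For every $t>0$, $$\lim_{x\uparrow t}f_c(t,x)=\tfrac12te^{-t}=\lim_{\varepsilon\downarrow0}\frac{P\{0<t-x(t)<\varepsilon\}}{\varepsilon},\qquad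 \lim_{x\downarrow-t}f_c(t,x)=0=\lim_{\varepsilon\downarrow0}\frac{P\{t+x(t)<\varepsilon\}}{\varepsilon},$$ where $x(t)$ is the position at time $t$ of the random motion with $2$-Erlang sojourn times and $v=\lambda=1$.
   Context: $I_k$ and $J_k$ denote respectively the modified Bessel function and the Bessel function of the first kind of order $k$. Random motion: a particle starts at $x(0)=0$ and moves on the real line with initial velocity $+1$. Let $\theta_1,\theta_2,\dots$ be independent random variables, each with the $2$-Erlang distribution with parameter $1$, i.e. density $s e^{-s}$ for $s>0$. At the times $\theta_1,\theta_1+\theta_2,\dots$ the velocity alternates between $+1$ and $-1$; so the velocity is $+1$ on $[0,\theta_1)$, $-1$ on $[\theta_1,\theta_1+\theta_2)$, and so on. $x(t)$ is the position at time $t$. *)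

(* Defs.v *)
From HB Require Import structures.
From mathcomp Require Import all_boot all_order all_algebra finmap.
From mathcomp Require Import all_classical all_reals all_analysis.

Set Implicit Arguments.
Unset Strict Implicit.
Unset Printing Implicit Defensive.

Import Order.TTheory GRing.Theory Num.Theory.
Import numFieldNormedType.Exports.

Local Open Scope classical_set_scope.
Local Open Scope ring_scope.

Section Bessel.
Context {R : realType}.

Definition besselI_coeff (k : nat) (z : R) : R^nat := fun m =>
  (z / 2) ^+ (2 * m + k) / (m`!%:R * (m + k)`!%:R).

Definition besselI (k : nat) (z : R) : R := limn (series (besselI_coeff k z)).

Definition besselJ_coeff (k : nat) (z : R) : R^nat := fun m =>
  (-1) ^+ m * (z / 2) ^+ (2 * m + k) / (m`!%:R * (m + k)`!%:R).

Definition besselJ (k : nat) (z : R) : R := limn (series (besselJ_coeff k z)).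

End Bessel.

Section PartialDerivatives.
Context {R : realType}.
Implicit Types f : R -> R -> R.

Definition partial_t f : R -> R -> R := fun t x => derive1 (f^~ x) t.

Definition partial_x f : R -> R -> R := fun t x => derive1 (f t) x.

(* All iterated partial derivatives of f of order at most n, taken in any
   order, exist at every point of the region |x| < t.  (The operator derive1 is
   total, so an equation between derivatives does not by itself say this.) *)
Fixpoint has_partials_in_cone (n : nat) f : Prop :=
  if n is m.+1 then
    [/\ forall t x : R, `|x| < t ->
          derivable (f^~ x) t 1 /\ derivable (f t) x 1,
        has_partials_in_cone m (partial_t f) &
        has_partials_in_cone m (partial_x f)]
  else True.

Definition op_minus f : R -> R -> R :=
  fun t x => partial_t f t x - partial_x f t x + f t x.

Definition op_plus f : R -> R -> R :=
  fun t x => partial_t f t x + partial_x f t x + f t x.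

End PartialDerivatives.

(* ui_j is the function written with subscript i and superscript j.  All these
   functions are only meant for |x| < t. *)
Section Density.
Context {R : realType}.

Definition zeta (t x : R) : R := Num.sqrt (t ^+ 2 - x ^+ 2).

Definition u0_0 (t x : R) : R :=
  2^-1 * (besselI 0 (zeta t x) + besselJ 0 (zeta t x)).

Definition u0_2 (t x : R) : R :=
  2^-1 * (besselI 0 (zeta t x) - besselJ 0 (zeta t x)).

Definition u1_1 (t x : R) : R :=
  x / zeta t x * (besselI 1 (zeta t x) + besselJ 1 (zeta t x)).

Definition u1_3 (t x : R) : R :=
  x / zeta t x * (besselI 1 (zeta t x) - besselJ 1 (zeta t x)).

Definition u2_1 (t x : R) : R :=
  t / zeta t x * (besselI 1 (zeta t x) + besselJ 1 (zeta t x)).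

Definition u2_3 (t x : R) : R :=
  t / zeta t x * (besselI 1 (zeta t x) - besselJ 1 (zeta t x)).

Definition u4_0 (t x : R) : R := 2 * partial_t u2_1 t x - 2 * u0_0 t x.

Definition g_c (t x : R) : R :=
  2^-1 * u0_2 t x
  + 4^-1 * (u1_1 t x + u1_3 t x + u2_1 t x + u2_3 t x + u4_0 t x).

Definition f_c (t x : R) : R := expR (- t) * g_c t x.

(* The generalized density f(t,x) = f_c(t,x) + e^{-t}(1+t) delta(t-x), as a
   function of sets: A is sent to the integral of f(t,.) over A. *)
Definition f_dist (t : R) (A : set R) : \bar R :=
  (\int[lebesgue_measure]_(x in A `&` `](- t)%R, t[) (f_c t x)%:E
   + (expR (- t) * (1 + t))%R%:E * \d_t A)%E.

End Density.

Section RandomMotion.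
Context {R : realType} {d : measure_display} {Omega : measurableType d}.
Variable P : probability Omega R.

Definition mutually_independent (theta : nat -> {RV P >-> R}) : Prop :=
  forall (J : {fset nat}) (A : nat -> set R),
    (forall i, measurable (A i)) ->
    P (\bigcap_(i in [set` J]) (theta i @^-1` A i)) =
    (\prod_(i <- J) P (theta i @^-1` A i))%E.

Definition erlang2_pdf (s : R) : R := if 0 < s then s * expR (- s) else 0.

Definition erlang2_distributed (X : {RV P >-> R}) : Prop :=
  forall A : set R, measurable A ->
    distribution P X A = (\int[lebesgue_measure]_(s in A) (erlang2_pdf s)%:E)%E.

(* theta i is the duration of the (i+1)-st sojourn; the n-th velocity change
   occurs at switch_time theta n, and switch_time theta 0 = 0. *)
Definition switch_time (theta : nat -> {RV P >-> R}) (n : nat) (w : Omega) : R :=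
  \sum_(i < n) theta i w.

Definition velocity (theta : nat -> {RV P >-> R}) (w : Omega) (s : R) : R :=
  \1_(\bigcup_k `[switch_time theta (2 * k)%N w,
                  switch_time theta (2 * k + 1)%N w[%classic) s
  - \1_(\bigcup_k `[switch_time theta (2 * k + 1)%N w,
                    switch_time theta (2 * k + 2)%N w[%classic) s.

Definition position (theta : nat -> {RV P >-> R}) (t : R) (w : Omega) : R :=
  \int[lebesgue_measure]_(s in `[0, t]) velocity theta w s.

End RandomMotion.

(* Main.v *)
Require Import Defs.
From HB Require Import structures.
From mathcomp Require Import all_boot all_order all_algebra finmap.
From mathcomp Require Import all_classical all_reals all_analysis.
From mathcomp Require Import measurable_realfun zify ring lra.

(** In the light-cone coordinates [a = (t + x) / 2], [b = (t - x) / 2] one has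
    [(z / 2)^2 = a * b], and the density becomes a double power series
    [g_c = 1/2 sum_(m odd) e m m + 1/2 sum_m e (m+1) m
         + 1/4 sum_(m odd) (e (m+2) m + e m (m+2))],
    where [e i j = a^i b^j / (i! j!)].
    - Conjugation by [e^{-t}] turns the two first-order operators into [d/db] and
      [d/da], which only lower an index, so [d^2/da^2 d^2/db^2] shifts [m] by two
      and fixes each of the sums.
    - Over [-t < x < t] the monomial [e i j] has integral
      [2 t^(i+j+1) / (i+j+1)!], and the sums together give all the terms
      [t^n / n!] with [n >= 2].
    - Up to a null set, [0 < t - x(t) < eps] differs from
      [t - eps/2 < theta_0 < t] only inside [theta_1 < eps/2], whose probability
      is [O(eps^2)], while [t + x(t) < eps] forces [theta_0 < eps/2]. *)

Set Implicit Arguments.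
Unset Strict Implicit.
Unset Printing Implicit Defensive.

Import Order.TTheory GRing.Theory Num.Theory.
Import numFieldNormedType.Exports.

Local Open Scope classical_set_scope.
Local Open Scope ring_scope.

(** * Bessel-Clifford series *)

Lemma scale_mulE {R : realType} (u v : R) : u *: v = u * v.
Proof. by []. Qed.

Section BesselClifford.
Context {R : realType}.
Implicit Types (c : R^nat) (a b s : R).

(** Bessel-Clifford normalization: [c = 1] gives [I_k] and [c m = (-1)^m] gives
    [J_k], through [(z/2)^k * clifford c k ((z/2)^2)]. *)
Definition clifford_coeff c (k : nat) : R^nat :=
  fun m => c m / (m`!%:R * (m + k)`!%:R).

Definition clifford c (k : nat) (s : R) : R :=
  limn (pseries (clifford_coeff c k) s).

(** This bound survives [shift_seq] and gives convergence everywhere, by comparison with the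
    exponential series. *)
Definition subunit c := forall m, `|c m| <= 1.

Definition shift_seq c : R^nat := fun m => c m.+1.

Lemma subunit_shift_seq c : subunit c -> subunit (shift_seq c).
Proof. by move=> c1 m; exact: c1. Qed.

Lemma factr_neq0 n : n`!%:R != 0 :> R.
Proof. by rewrite pnatr_eq0 -lt0n fact_gt0. Qed.

(** The factor m + 1 from differentiation cancels inside (m + 1)!, so a derivative shifts the
    sequence and raises the order by one. *)
Lemma clifford_coeff_diffs c k :
  pseries_diffs (clifford_coeff c k) = clifford_coeff (shift_seq c) k.+1.
Proof.
apply/funext => m; rewrite /pseries_diffs /clifford_coeff /shift_seq addSnnS.
rewrite [in LHS]factS [in LHS]natrM.
by field; rewrite !factr_neq0 nat1r pnatr_eq0.
Qed.

Lemma is_cvg_clifford c k s : subunit c ->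
  cvgn (pseries (clifford_coeff c k) s).
Proof.
move=> c1; apply: normed_cvg.
apply: series_le_cvg (is_cvg_series_exp_coeff `|s|) => m /=.
- exact: normr_ge0.
- by rewrite divr_ge0.
rewrite /clifford_coeff normrM normrX mulrC ler_wpM2l ?exprn_ge0 ?normr_ge0//.
rewrite normrM normfV (ger0_norm (x := _ * _)) ?mulr_ge0//.
rewrite ler_pdivrMr ?mulr_gt0 ?ltr0n ?fact_gt0//.
rewrite mulrA mulVf ?factr_neq0// mul1r.
by rewrite (le_trans (c1 m))// ler1n fact_gt0.
Qed.

Lemma is_derive_clifford c k s : subunit c ->
  is_derive s 1 (clifford c k) (clifford (shift_seq c) k.+1 s).
Proof.
move=> c1; rewrite /clifford -clifford_coeff_diffs.
(* Any radius beyond the modulus of [s] serves, since the series and its formal derivatives converge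
   everywhere. *)
apply: (@pseries_snd_diffs _ _ (`|s| + 1)); rewrite ?clifford_coeff_diffs.
- exact: is_cvg_clifford.
- exact/is_cvg_clifford/subunit_shift_seq.
- exact/is_cvg_clifford/subunit_shift_seq/subunit_shift_seq.
- by rewrite [ltRHS]ger0_norm ?addr_ge0// ltrDl.
Qed.

Lemma clifford_lin a b c c' k s : subunit c -> subunit c' ->
  a * clifford c k s + b * clifford c' k s
  = clifford (fun m => a * c m + b * c' m) k s.
Proof.
move=> c1 c1'.
have := is_cvg_clifford (k := k) (s := s) c1.
have := is_cvg_clifford (k := k) (s := s) c1'.
rewrite /clifford /pseries => h' h.
rewrite -[a * _]/(a *: _) -[b * _]/(b *: _) -!lim_seriesZ//.
rewrite -lim_seriesD; [|exact: is_cvg_seriesZ..].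
congr (limn (series _)); apply/funext => m.
rewrite /clifford_coeff /= -[LHS]/(a * (_ * _) + b * (_ * _)); ring.
Qed.

(** The shifted series weights term m of order k + 1 by m, and m + k + 1 cancels the last factor of
    (m + k + 1)!. For the constant sequence 1 this is the classical I_k - I_(k+2) = (2(k+1)/z)
    I_(k+1). *)
Lemma clifford_recurrence c k s : subunit c ->
  k.+1%:R * clifford c k.+1 s + s * clifford (shift_seq c) k.+2 s = clifford c k s.
Proof.
move=> c1.
have h := is_cvg_clifford (k := k.+1) (s := s) c1.
have h2 := is_cvg_clifford (k := k.+2) (s := s) (subunit_shift_seq c1).
have := pseries_diffs_equiv (f := clifford_coeff c k.+1) (x := s).
rewrite clifford_coeff_diffs => /(_ h2) h3.
have h4 : series (fun i => i%:R * clifford_coeff c k.+1 i * s ^+ i) @ \oo -->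
    s * clifford (shift_seq c) k.+2 s.
  suff -> : series (fun i => i%:R * clifford_coeff c k.+1 i * s ^+ i) =
      (fun n => s * series
        (fun i => i%:R * clifford_coeff c k.+1 i * s ^+ i.-1) n).
    exact: cvgMl_tmp.
  (* The term of index 0 vanishes, so the truncated predecessor does no harm. *)
  apply/funext => n; rewrite /series/= mulr_sumr; apply: eq_bigr => -[|i] _ /=.
    by rewrite !mul0r mulr0.
  by rewrite exprS; ring.
rewrite -(cvg_lim (@Rhausdorff _) h4) /clifford /pseries.
rewrite -[k.+1%:R * _]/(k.+1%:R *: _) -lim_seriesZ// -lim_seriesD; last 2 first.
- exact: is_cvg_seriesZ.
- exact: cvgP h4.
congr (limn (series _)); apply/funext => m /=; rewrite /clifford_coeff /=.
rewrite -[LHS]/(_ * (_ * _) + _) addnS factS natrM -addnS natrD.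
by field; rewrite !factr_neq0 nat1r -natrD addnS pnatr_eq0.
Qed.

(** The series [sum_m c m * a^(m+k) b^m / ((m+k)! m!)]. *)
Definition lightwave c k (a b : R) : R := a ^+ k * clifford c k (a * b).

Lemma lightwave0C c a b : lightwave c 0 a b = lightwave c 0 b a.
Proof. by rewrite /lightwave mulrC [b * a]mulrC mulrC. Qed.

(** At order 0, lowering the power of [a] leaves the surplus power on [b], so the arguments swap. *)
Definition lightwave_da c k a b : R :=
  if k is j.+1 then lightwave c j a b else lightwave (shift_seq c) 1 b a.

Definition lightwave_db c k a b : R := lightwave (shift_seq c) k.+1 a b.

Lemma is_derive_lightwave c k (a b : R -> R) (y da db : R) : subunit c ->
  is_derive y 1 a da -> is_derive y 1 b db ->
  is_derive y 1 (fun y => lightwave c k (a y) (b y))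
    (da * lightwave_da c k (a y) (b y) + db * lightwave_db c k (a y) (b y)).
Proof.
move=> c1 ha hb; rewrite /lightwave.
have hab := is_deriveM ha hb.
have hB : is_derive y 1 (clifford c k \o (a * b))
    (clifford (shift_seq c) k.+1 (a y * b y) * (a y *: db + b y *: da)).
  by apply: is_derive1_comp => //; exact: is_derive_clifford.
have -> : (fun y => a y ^+ k * clifford c k (a y * b y)) =
  a ^+ k * (clifford c k \o (a * b)).
  by apply/funext => u; rewrite /= mulrfctE exprfctE.
apply: (is_derive_eq (is_deriveM (is_deriveX k ha) hB)) => /=.
rewrite !scale_mulE [(a * b) y]/(a y * b y) exprfctE.
rewrite /lightwave_db /lightwave exprS.
case: k {hB} => [|k] /=.
  by rewrite /lightwave expr0 expr1 [b y * a y]mulrC mulr0n; ring.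
(* The coefficient of [da] is [a y ^+ k] times the left side of the recurrence. *)
rewrite /lightwave -(clifford_recurrence k (a y * b y) c1) !exprS; ring.
Qed.

End BesselClifford.

(** * Light-cone coordinates *)

Section LightConeCoordinates.
Context {R : realType}.
Implicit Types (c : R^nat) (F G H A B : R -> R -> R) (t x : R).

Definition fwd c k t x := lightwave c k ((t + x) / 2) ((t - x) / 2).
Definition bwd c k t x := lightwave c k ((t - x) / 2) ((t + x) / 2).

(** With a = (t + x)/2 and b = (t - x)/2, [A] and [B] are the partial derivatives of [G] in a and
    b. *)
Definition light_deriv G A B := forall t x,
  is_derive t 1 (G^~ x) ((A t x + B t x) / 2) /\
  is_derive x 1 (G t) ((A t x - B t x) / 2).

Lemma is_derive_addhalf (x y : R) : is_derive y 1 (fun y => (y + x) / 2) (2^-1).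
Proof.
have -> : (fun y => (y + x) / 2) = 2^-1 \*: (id + cst x).
  by apply/funext => u; rewrite /= mulrC.
by apply: is_derive_eq; rewrite addr0 -[LHS]/(_ * _) mulr1.
Qed.

Lemma is_derive_subhalf (x y : R) :
  is_derive y 1 (fun y => (x - y) / 2) (- 2^-1).
Proof.
have -> : (fun y => (x - y) / 2) = 2^-1 \*: (cst x - id).
  by apply/funext => u; rewrite /= mulrC.
by apply: is_derive_eq; rewrite sub0r -[LHS]/(_ * _) mulrN1.
Qed.

Lemma is_derive_addhalfr (x y : R) :
  is_derive y 1 (fun y => (x + y) / 2) (2^-1).
Proof. by under eq_fun do rewrite addrC; exact: is_derive_addhalf. Qed.

Lemma light_deriv_fwd c k : subunit c ->
  light_deriv (fwd c k)
    (fun t x => lightwave_da c k ((t + x) / 2) ((t - x) / 2))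
    (fwd (shift_seq c) k.+1).
Proof.
move=> c1 t x; split.
- apply: (is_derive_eq (is_derive_lightwave k c1
    (is_derive_addhalf x t) (is_derive_addhalf (- x) t))).
  by rewrite /fwd /lightwave_db; ring.
- apply: (is_derive_eq (is_derive_lightwave k c1
    (is_derive_addhalfr t x) (is_derive_subhalf t x))).
  by rewrite /fwd /lightwave_db; ring.
Qed.

Lemma light_deriv_bwd c k : subunit c ->
  light_deriv (bwd c k) (bwd (shift_seq c) k.+1)
    (fun t x => lightwave_da c k ((t - x) / 2) ((t + x) / 2)).
Proof.
move=> c1 t x; split.
- apply: (is_derive_eq (is_derive_lightwave k c1
    (is_derive_addhalf (- x) t) (is_derive_addhalf x t))).
  by rewrite /bwd /lightwave_db; ring.
- apply: (is_derive_eq (is_derive_lightwave k c1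
    (is_derive_subhalf t x) (is_derive_addhalfr t x))).
  by rewrite /bwd /lightwave_db; ring.
Qed.

Lemma light_derivD G H A B A' B' :
  light_deriv G A B -> light_deriv H A' B' ->
  light_deriv (fun t x => G t x + H t x)
    (fun t x => A t x + A' t x) (fun t x => B t x + B' t x).
Proof.
move=> hG hH t x; have [Gt Gx] := hG t x; have [Ht Hx] := hH t x; split.
- by apply: (is_derive_eq (is_deriveD Gt Ht)); ring.
- by apply: (is_derive_eq (is_deriveD Gx Hx)); ring.
Qed.

Lemma light_derivZ a G A B : light_deriv G A B ->
  light_deriv (fun t x => a * G t x)
    (fun t x => a * A t x) (fun t x => a * B t x).
Proof.
move=> hG t x; have [Gt Gx] := hG t x; split.
- by apply: (is_derive_eq (is_deriveZ a Gt)); rewrite -[LHS]/(_ * _); ring.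
- by apply: (is_derive_eq (is_deriveZ a Gx)); rewrite -[LHS]/(_ * _); ring.
Qed.

(** A class closed under both light-cone derivatives, hence smooth to every order. It contains both
    families because a derivative of an order-0 wave may lie in the other one. *)
Inductive wavespan : (R -> R -> R) -> Prop :=
| wavespan_fwd c k of subunit c : wavespan (fwd c k)
| wavespan_bwd c k of subunit c : wavespan (bwd c k)
| wavespanD G H of wavespan G & wavespan H :
    wavespan (fun t x => G t x + H t x)
| wavespanZ a G of wavespan G : wavespan (fun t x => a * G t x).

Lemma wavespan_light_deriv G : wavespan G ->
  exists A B, [/\ wavespan A, wavespan B & light_deriv G A B].
Proof.
elim=> {G} [c k c1|c k c1|G H _ [A [B [hA hB hG]]] _ [A' [B' [hA' hB' hH]]]
    |a G _ [A [B [hA hB hG]]]].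
- eexists; eexists; split; last exact: light_deriv_fwd.
  + case: k => [|k] /=; [exact/wavespan_bwd/subunit_shift_seq|exact: wavespan_fwd].
  + exact/wavespan_fwd/subunit_shift_seq.
- eexists; eexists; split; last exact: light_deriv_bwd.
  + exact/wavespan_bwd/subunit_shift_seq.
  + case: k => [|k] /=; [exact/wavespan_fwd/subunit_shift_seq|exact: wavespan_bwd].
- by do 2 eexists; split; last exact: light_derivD hG hH; exact: wavespanD.
- by do 2 eexists; split; last exact: light_derivZ hG; exact: wavespanZ.
Qed.

Definition cone_eq F G := forall t x, `|x| < t -> F t x = G t x.

Lemma cone_near_t t x : `|x| < t -> \forall t' \near t, `|x| < t'.
Proof. exact: lt_nbhsr. Qed.

Lemma cone_near_x t x : `|x| < t -> \forall x' \near x, `|x'| < t.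
Proof.
rewrite ltr_norml => /andP[tx xt]; near=> x'; rewrite ltr_norml.
by apply/andP; split; near: x'; [exact: lt_nbhsr|exact: lt_nbhsl].
Unshelve. all: end_near. Qed.

(** The cone is open, so an identity that holds only inside it still determines the derivatives
    there. *)
Lemma cone_eq_is_derive_t F G t x d : cone_eq F G -> `|x| < t ->
  is_derive t 1 (G^~ x) d -> is_derive t 1 (F^~ x) d.
Proof.
move=> FG xt; apply: near_eq_is_derive => //; near=> t'; apply/esym/FG.
by near: t'; exact: cone_near_t.
Unshelve. all: end_near. Qed.

Lemma cone_eq_is_derive_x F G t x d : cone_eq F G -> `|x| < t ->
  is_derive x 1 (G t) d -> is_derive x 1 (F t) d.
Proof.
move=> FG xt; apply: near_eq_is_derive => //; near=> x'; apply/esym/FG.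
by near: x'; exact: cone_near_x.
Unshelve. all: end_near. Qed.

Definition damped G t x := expR (- t) * G t x.

Lemma is_derive_damped_t G A B t x : light_deriv G A B ->
  is_derive t 1 ((damped G)^~ x)
    (damped (fun t x => 2^-1 * A t x + 2^-1 * B t x + -1 * G t x) t x).
Proof.
move=> hG; have [Gt _] := hG t x.
have hE : is_derive t 1 (fun t => expR (- t)) (expR (- t) * -1).
  by apply: is_derive1_comp.
have := is_deriveM hE Gt.
move=> h; apply: (is_derive_eq h); rewrite /damped.
by rewrite !scale_mulE; ring.
Qed.

Lemma is_derive_damped_x G A B t x : light_deriv G A B ->
  is_derive x 1 (damped G t)
    (damped (fun t x => 2^-1 * A t x + (- 2^-1) * B t x) t x).
Proof.
move=> hG; have [_ Gx] := hG t x.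
apply: (is_derive_eq (is_deriveZ (expR (- t)) Gx)).
by rewrite /damped -[LHS]/(_ * _); ring.
Qed.

(** The induction ranges over every [F] that agrees with a damped wave inside the cone, because the
    partials of [F] are identified only there. *)
Lemma wavespan_has_partials n F G : wavespan G -> cone_eq F (damped G) ->
  has_partials_in_cone n F.
Proof.
elim: n F G => [//|n IH] F G wG FG.
have [A [B [wA wB hG]]] := wavespan_light_deriv wG.
split.
- move=> t x xt; split.
  + by have [] := cone_eq_is_derive_t FG xt (is_derive_damped_t t x hG).
  + by have [] := cone_eq_is_derive_x FG xt (is_derive_damped_x t x hG).
- apply: (IH _ (fun t x => 2^-1 * A t x + 2^-1 * B t x + -1 * G t x)).
    by do 2 (apply: wavespanD; last exact: wavespanZ); exact: wavespanZ.
  move=> t x xt; rewrite /partial_t derive1E.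
  by have [_ ->] := cone_eq_is_derive_t FG xt (is_derive_damped_t t x hG).
- apply: (IH _ (fun t x => 2^-1 * A t x + (- 2^-1) * B t x)).
    by apply: wavespanD; exact: wavespanZ.
  move=> t x xt; rewrite /partial_x derive1E.
  by have [_ ->] := cone_eq_is_derive_x FG xt (is_derive_damped_x t x hG).
Qed.

(** The halves of A + B and A - B add up to [A], and the derivative of e^{-t} cancels the term +1.
    The minus operator leaves [B] in the same way. *)
Lemma op_plus_damped F G A B : light_deriv G A B -> cone_eq F (damped G) ->
  cone_eq (op_plus F) (damped A).
Proof.
move=> hG FG t x xt; rewrite /op_plus /partial_t /partial_x !derive1E FG//.
have [_ ->] := cone_eq_is_derive_t FG xt (is_derive_damped_t t x hG).
have [_ ->] := cone_eq_is_derive_x FG xt (is_derive_damped_x t x hG).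
by rewrite /damped; field.
Qed.

Lemma op_minus_damped F G A B : light_deriv G A B -> cone_eq F (damped G) ->
  cone_eq (op_minus F) (damped B).
Proof.
move=> hG FG t x xt; rewrite /op_minus /partial_t /partial_x !derive1E FG//.
have [_ ->] := cone_eq_is_derive_t FG xt (is_derive_damped_t t x hG).
have [_ ->] := cone_eq_is_derive_x FG xt (is_derive_damped_x t x hG).
by rewrite /damped; field.
Qed.

End LightConeCoordinates.

(** * The density as a sum of four waves, and its differential equation *)

Section DensityInLightConeCoordinates.
Context {R : realType}.
Implicit Types (c : R^nat) (t x z : R).

(** Up to a power of z/2, these four sequences give I, J, half their sum and half their
    difference. *)
Definition one_seq : R^nat := fun=> 1.
Definition sgn_seq : R^nat := fun m => (-1) ^+ m.
Definition even_seq : R^nat := fun m => (~~ odd m)%:R.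
Definition odd_seq : R^nat := fun m => (odd m)%:R.

Lemma subunit_one : subunit one_seq. Proof. by move=> m; rewrite normr1. Qed.

Lemma subunit_sgn : subunit sgn_seq.
Proof. by move=> m; rewrite /sgn_seq normrX normrN1 expr1n. Qed.

Lemma subunit_even : subunit even_seq.
Proof. by move=> m; rewrite /even_seq; case: odd; rewrite ?normr0 ?normr1. Qed.

Lemma subunit_odd : subunit odd_seq.
Proof. by move=> m; rewrite /odd_seq; case: odd; rewrite ?normr0 ?normr1. Qed.

Lemma shift_one_seq : shift_seq one_seq = one_seq. Proof. by []. Qed.

Lemma shift_even_seq : shift_seq even_seq = odd_seq.
Proof.
by apply/funext => m; rewrite /shift_seq /even_seq /odd_seq /= negbK.
Qed.

Lemma shift_odd_seq : shift_seq odd_seq = even_seq.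
Proof. by apply/funext. Qed.

Lemma clifford_one_add_sgn k s : clifford one_seq k s + clifford sgn_seq k s
  = 2 * clifford even_seq k s.
Proof.
rewrite -[X in X + _]mul1r -[X in _ + X]mul1r.
rewrite (clifford_lin _ _ _ _ subunit_one subunit_sgn).
(* A zero multiple is added so that [clifford_lin] fits this side too. *)
have -> : 2 * clifford even_seq k s =
  2 * clifford even_seq k s + 0 * clifford even_seq k s by ring.
rewrite (clifford_lin _ _ _ _ subunit_even subunit_even).
congr (clifford _ k s); apply/funext => m.
by rewrite /one_seq /sgn_seq /even_seq -signr_odd; case: odd => /=; ring.
Qed.

Lemma clifford_one_sub_sgn k s : clifford one_seq k s - clifford sgn_seq k s
  = 2 * clifford odd_seq k s.
Proof.
rewrite -[X in X - _]mul1r -mulN1r.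
rewrite (clifford_lin _ _ _ _ subunit_one subunit_sgn).
have -> : 2 * clifford odd_seq k s =
  2 * clifford odd_seq k s + 0 * clifford odd_seq k s by ring.
rewrite (clifford_lin _ _ _ _ subunit_odd subunit_odd).
congr (clifford _ k s); apply/funext => m.
by rewrite /one_seq /sgn_seq /odd_seq -signr_odd; case: odd => /=; ring.
Qed.

Lemma clifford_bessel c k z : subunit c ->
  limn (series (fun m => c m * (z / 2) ^+ (2 * m + k) / (m`!%:R * (m + k)`!%:R)))
  = (z / 2) ^+ k * clifford c k ((z / 2) ^+ 2).
Proof.
move=> c1; have h := is_cvg_clifford (k := k) (s := (z / 2) ^+ 2) c1.
rewrite -[RHS]/(_ *: _) /clifford -lim_seriesZ//.
congr (limn (series _)); apply/funext => m.
rewrite -[RHS]/(_ * (_ * _)) /clifford_coeff exprD exprM; ring.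
Qed.

Lemma besselIE k z :
  besselI k z = (z / 2) ^+ k * clifford one_seq k ((z / 2) ^+ 2).
Proof.
rewrite -clifford_bessel; last exact: subunit_one.
congr (limn (series _)); apply/funext => m.
by rewrite /besselI_coeff /one_seq mul1r.
Qed.

Lemma besselJE k z :
  besselJ k z = (z / 2) ^+ k * clifford sgn_seq k ((z / 2) ^+ 2).
Proof. by rewrite -clifford_bessel//; exact: subunit_sgn. Qed.

Lemma zeta_gt0 t x : `|x| < t -> 0 < zeta t x.
Proof.
rewrite ltr_norml => /andP[tx xt]; rewrite sqrtr_gt0 subr_sqr mulr_gt0//; lra.
Qed.

Lemma zeta2E t x : `|x| < t ->
  (zeta t x / 2) ^+ 2 = (t + x) / 2 * ((t - x) / 2).
Proof.
rewrite ltr_norml => /andP[tx xt]; rewrite expr_div_n sqr_sqrtr; last first.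
  by rewrite subr_sqr mulr_ge0//; lra.
by field.
Qed.

(** No quotient by [zeta] is left in this form, so it extends across the wave fronts. *)
Definition g_light t x : R :=
  2^-1 * fwd odd_seq 0 t x + 2^-1 * fwd one_seq 1 t x
  + 4^-1 * fwd odd_seq 2 t x + 4^-1 * bwd odd_seq 2 t x.

(** The factor z/2 of the order-one Bessel functions cancels the quotient by z, and the remaining t
    splits as a + b. *)
Lemma u2_1E : cone_eq (@u2_1 R)
  (fun t x => fwd even_seq 1 t x + bwd even_seq 1 t x).
Proof.
move=> t x xt; rewrite /u2_1 besselIE besselJE !expr1 -mulrDr clifford_one_add_sgn zeta2E//.
rewrite /fwd /bwd /lightwave [(t - x) / 2 * _]mulrC.
by field; rewrite gt_eqF// zeta_gt0.
Qed.

Lemma u0_0E : cone_eq (@u0_0 R) (fwd even_seq 0).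
Proof.
move=> t x xt; rewrite /u0_0 besselIE besselJE !expr0 !mul1r clifford_one_add_sgn zeta2E//.
by rewrite /fwd /lightwave expr0; field.
Qed.

(** The time derivative of [u2_1] produces two waves of order 0 and two of order 2. Those of order 0
    coincide and are removed by [2 * u0_0]. *)
Lemma u4_0E : cone_eq (@u4_0 R)
  (fun t x => fwd odd_seq 2 t x + bwd odd_seq 2 t x).
Proof.
move=> t x xt; rewrite /u4_0 /partial_t derive1E u0_0E//.
have h := light_derivD (light_deriv_fwd 1 subunit_even)
  (light_deriv_bwd 1 subunit_even).
have [ht _] := h t x.
have [_ ->] := cone_eq_is_derive_t u2_1E xt ht.
rewrite shift_even_seq /= -/(fwd even_seq 0 t x) -/(bwd even_seq 0 t x).
have -> : bwd even_seq 0 t x = fwd even_seq 0 t x.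
  by rewrite /bwd /fwd lightwave0C.
by field.
Qed.

Lemma f_cE : cone_eq (@f_c R) (damped g_light).
Proof.
move=> t x xt; rewrite /f_c /damped /g_c u4_0E//; congr (_ * _).
have -> : u0_2 t x = fwd odd_seq 0 t x.
  rewrite /u0_2 besselIE besselJE !expr0 !mul1r clifford_one_sub_sgn zeta2E//.
  by rewrite /fwd /lightwave expr0; field.
(* J_1 cancels in each pair, leaving (2(t + x)/z) I_1, where t + x = 2a. *)
have -> : u1_1 t x + u1_3 t x + u2_1 t x + u2_3 t x = 2 * fwd one_seq 1 t x.
  rewrite /u1_1 /u1_3 /u2_1 /u2_3 !besselIE !besselJE !expr1 zeta2E//.
  by rewrite /fwd /lightwave; field; rewrite gt_eqF// zeta_gt0.
by rewrite /g_light; field.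
Qed.

Lemma wavespan_g_light : wavespan g_light.
Proof.
exact: (wavespanD (wavespanD (wavespanD
  (wavespanZ _ (wavespan_fwd 0 subunit_odd))
  (wavespanZ _ (wavespan_fwd 1 subunit_one)))
  (wavespanZ _ (wavespan_fwd 2 subunit_odd)))
  (wavespanZ _ (wavespan_bwd 2 subunit_odd))).
Qed.

Lemma f_c_has_partials n : has_partials_in_cone n (@f_c R).
Proof. exact: wavespan_has_partials wavespan_g_light f_cE. Qed.

Lemma light_deriv_comb (a b d e : R) (G H K L A A' B B' C C' D D' : R -> R -> R) :
  light_deriv G A A' -> light_deriv H B B' -> light_deriv K C C' ->
  light_deriv L D D' ->
  light_deriv (fun t x => a * G t x + b * H t x + d * K t x + e * L t x)
   (fun t x => a * A t x + b * B t x + d * C t x + e * D t x)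
   (fun t x => a * A' t x + b * B' t x + d * C' t x + e * D' t x).
Proof.
move=> hG hH hK hL.
exact: (light_derivD (light_derivD (light_derivD (light_derivZ a hG)
  (light_derivZ b hH)) (light_derivZ d hK)) (light_derivZ e hL)).
Qed.

(** A derivative in the surplus variable lowers the order of a wave and keeps its sequence; in the
    other variable, or at order 0, it raises the order and shifts the sequence. Over two derivatives
    in a and two in b, each [odd_seq] wave is shifted twice and so regains its parity and order. *)
Lemma f_c_pde t x : `|x| < t ->
  iter 2 op_minus (iter 2 op_plus f_c) t x - f_c t x = 0.
Proof.
move=> xt; rewrite /=.
have odd1 := subunit_odd; have one1 := subunit_one; have even1 := subunit_even.
have h1 := op_plus_damped (light_deriv_comb 2^-1 2^-1 4^-1 4^-1
  (light_deriv_fwd 0 odd1) (light_deriv_fwd 1 one1) (light_deriv_fwd 2 odd1)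
  (light_deriv_bwd 2 odd1)) f_cE.
rewrite /lightwave_da !shift_odd_seq in h1.
have h2 := op_plus_damped (light_deriv_comb 2^-1 2^-1 4^-1 4^-1
  (light_deriv_bwd 1 even1) (light_deriv_fwd 0 one1) (light_deriv_fwd 1 odd1)
  (light_deriv_bwd 3 even1)) h1.
rewrite /lightwave_da !shift_even_seq !shift_one_seq in h2.
have h3 := op_minus_damped (light_deriv_comb 2^-1 2^-1 4^-1 4^-1
  (light_deriv_bwd 2 odd1) (light_deriv_bwd 1 one1) (light_deriv_fwd 0 odd1)
  (light_deriv_bwd 4 odd1)) h2.
rewrite /lightwave_da !shift_odd_seq in h3.
have h4 := op_minus_damped (light_deriv_comb 2^-1 2^-1 4^-1 4^-1
  (light_deriv_bwd 1 odd1) (light_deriv_bwd 0 one1) (light_deriv_fwd 1 even1)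
  (light_deriv_bwd 3 odd1)) h3.
rewrite /lightwave_da !shift_even_seq !shift_one_seq in h4.
(* The first summand returns with its arguments exchanged, which changes nothing at order 0. *)
rewrite h4// f_cE// /damped /g_light lightwave0C -/(fwd odd_seq 0 t x).
by rewrite -/(fwd one_seq 1 t x) -/(bwd odd_seq 2 t x); ring.
Qed.

(** * Limits of the density at the wave fronts *)

Lemma clifford0 c k : clifford c k 0 = c 0%N / k`!%:R.
Proof.
(* The empty partial sum is 0; the sequence is constant only from the next one on. *)
apply: cvg_lim => //; rewrite -cvg_shiftS /=.
apply: (@cvg_trans _ (cst (c 0%N / k`!%:R) @ \oo)); last exact: cvg_cst.
apply: near_eq_cvg; near=> n.
rewrite /pseries /series/= big_nat_recl// big1 => [|i _].
  by rewrite expr0 /clifford_coeff fact0 add0n mul1r addr0 mulr1.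
by rewrite exprS mul0r mulr0.
Unshelve. all: end_near. Qed.

(** Since b = 0, only the terms of index 0 can survive; [odd_seq] vanishes there, and the [one_seq]
    wave remains. *)
Lemma g_light_right t : g_light t t = 2^-1 * t.
Proof.
rewrite /g_light /fwd /bwd /lightwave subrr mul0r mulr0 !clifford0 /odd_seq /=.
by rewrite !mul0r /one_seq factS fact0 muln1; field.
Qed.

(** Here a = 0, and the surplus factor a removes the [one_seq] wave as well. *)
Lemma g_light_left t : g_light t (- t) = 0.
Proof.
rewrite /g_light /fwd /bwd /lightwave subrr mul0r mul0r opprK mulr0 !clifford0.
by rewrite /odd_seq /= expr1 !mul0r; ring.
Qed.

Lemma continuous_damped_g_light t : continuous (damped g_light t).
Proof.
move=> x; have [A [B [_ _ h]]] := wavespan_light_deriv wavespan_g_light.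
have [d _] := is_derive_damped_x t x h.
exact/differentiable_continuous/derivable1_diffP.
Qed.

Lemma f_c_cvg_right t : 0 < t -> f_c t x @[x --> t^'-] --> 2^-1 * t * expR (- t).
Proof.
move=> t0; rewrite mulrC -g_light_right -/(damped g_light t t).
apply: cvg_trans (cvg_at_left_filter (@continuous_damped_g_light t t)).
apply: near_eq_cvg; near=> x; apply/esym/f_cE.
by rewrite ltr_norml; apply/andP; split; near: x;
  [apply: nbhs_left_gt; lra|exact: nbhs_left_lt].
Unshelve. all: end_near. Qed.

Lemma f_c_cvg_left t : 0 < t -> f_c t x @[x --> (- t)^'+] --> (0 : R).
Proof.
move=> t0; rewrite -(mulr0 (expR (- t))) -(g_light_left t) -/(damped g_light t (- t)).
apply: cvg_trans (cvg_at_right_filter (@continuous_damped_g_light t (- t))).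
apply: near_eq_cvg; near=> x; apply/esym/f_cE.
by rewrite ltr_norml; apply/andP; split; near: x;
  [exact: nbhs_right_gt|apply: nbhs_right_lt; lra].
Unshelve. all: end_near. Qed.

End DensityInLightConeCoordinates.

(** * Total mass *)

Section MassOfDensity.
Context {R : realType}.
Implicit Types (t x y : R) (a b n : nat).
Let mu := @lebesgue_measure R.

Lemma integral_derivative (f F : R -> R) (a b : R) : a < b -> continuous f ->
  (forall x, is_derive x 1 F (f x)) ->
  (\int[mu]_(x in `]a, b[) (f x)%:E = (F b - F a)%:E)%E.
Proof.
move=> ab cf dF.
have cF : continuous F.
  by move=> x; have [dFx _] := dF x;
     exact/differentiable_continuous/derivable1_diffP.
rewrite -(@integral_itv_bndoo _ _ _ _ true false); last first.
  by apply/measurable_EFinP; apply: measurable_funTS;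
     exact: continuous_measurable_fun.
rewrite (@continuous_FTC2 _ f F)//.
- exact: continuous_subspaceT.
- split.
  + by move=> x _; have [] := dF x.
  + exact/cvg_at_right_filter/cF.
  + exact/cvg_at_left_filter/cF.
- by move=> x _; rewrite derive1E; have [_ ->] := dF x.
Qed.

(** * Divided powers and the integrals of the monomials *)

Definition dpow n y : R := y ^+ n / n`!%:R.

Lemma dpow_ge0 n y : 0 <= y -> 0 <= dpow n y.
Proof. by move=> y0; rewrite divr_ge0// exprn_ge0. Qed.

Lemma dpow0 y : dpow 0 y = 1.
Proof. by rewrite /dpow expr0 fact0 divr1. Qed.

Lemma dpowS0 n : dpow n.+1 0 = 0.
Proof. by rewrite /dpow exprS !mul0r. Qed.

Lemma is_derive_dpow n (h : R -> R) y dh : is_derive y 1 h dh ->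
  is_derive y 1 (fun y => dpow n (h y))
    (dh * if n is m.+1 then dpow m (h y) else 0).
Proof.
move=> hd; have -> : (fun y => dpow n (h y)) = (n`!%:R)^-1 \*: (h ^+ n).
  by apply/funext => u; rewrite /dpow /= mulrC -[(h ^+ n) u]/_ exprfctE.
apply: (is_derive_eq (is_deriveZ _ (is_deriveX n hd))).
rewrite !scale_mulE; case: n => [|n]; first by rewrite mulr0n; ring.
by rewrite /dpow factS /=; field; rewrite factr_neq0 nat1r pnatr_eq0.
Qed.

Definition mono a b t x : R := dpow a ((t + x) / 2) * dpow b ((t - x) / 2).

(** The derivative of [2 * mono i j] in [x] is
    [mono (i-1) j - mono i (j-1)], so the sum of [2 * mono (a+1+j) (b-j)] over
    [j <= b] telescopes to a primitive of [mono a b]. *)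
Fixpoint mono_prim b a t x : R :=
  if b is c.+1 then mono_prim c a.+1 t x + 2 * mono a.+1 b t x
  else 2 * mono a.+1 0 t x.

Lemma is_derive_mono a b t x : is_derive x 1 (mono a b t)
  (2^-1 * ((if a is c.+1 then mono c b t x else 0)
         - (if b is c.+1 then mono a c t x else 0))).
Proof.
have ha := is_derive_dpow a (is_derive_addhalfr t x).
have hb := is_derive_dpow b (is_derive_subhalf t x).
apply: (is_derive_eq (is_deriveM ha hb)).
by rewrite !scale_mulE /mono; case: a {ha} => [|a]; case: b {hb} => [|b]; ring.
Qed.

Lemma is_derive_mono_prim b a t x :
  is_derive x 1 (mono_prim b a t) (mono a b t x).
Proof.
elim: b a => [|b IH] a /=.
  apply: (is_derive_eq (is_deriveZ 2 (is_derive_mono a.+1 0 t x))).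
  by rewrite !scale_mulE; field.
apply: (is_derive_eq (is_deriveD (IH a.+1)
  (is_deriveZ 2 (is_derive_mono a.+1 b.+1 t x)))).
by rewrite !scale_mulE; field.
Qed.

(** Every monomial of the primitive has a positive first exponent, and its base (t + x)/2 is 0
    here. *)
Lemma mono_prim_left b a t : mono_prim b a t (- t) = 0.
Proof.
have h c d : mono c.+1 d t (- t) = 0 by rewrite /mono subrr mul0r dpowS0 mul0r.
by elim: b a => [|b IH] a /=; rewrite ?IH h; ring.
Qed.

(** As (t - x)/2 is 0 here, only the innermost summand, of second exponent 0, survives. *)
Lemma mono_prim_right b a t : mono_prim b a t t = 2 * dpow (a + b).+1 t.
Proof.
elim: b a => [|b IH] a /=; rewrite /mono subrr mul0r.
  by rewrite dpow0 mulr1 addn0; congr (_ * dpow _ _); field.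
by rewrite IH dpowS0 !mulr0 addr0 addSnnS.
Qed.

Lemma mono_ge0 a b t x : `|x| <= t -> 0 <= mono a b t x.
Proof.
rewrite ler_norml => /andP[tx xt].
by rewrite mulr_ge0// dpow_ge0// divr_ge0//; lra.
Qed.

(** * Termwise integration of the series *)

Definition g_light_term t n x : R :=
  2^-1 * (odd_seq n * mono n n t x) + 2^-1 * mono n.+1 n t x
  + 4^-1 * (odd_seq n * mono n.+2 n t x) + 4^-1 * (odd_seq n * mono n n.+2 t x).

Definition g_light_term_prim t n x : R :=
  2^-1 * (odd_seq n * mono_prim n n t x) + 2^-1 * mono_prim n n.+1 t x
  + 4^-1 * (odd_seq n * mono_prim n n.+2 t x)
  + 4^-1 * (odd_seq n * mono_prim n.+2 n t x).

Lemma is_derive_g_light_term_prim t n x :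
  is_derive x 1 (g_light_term_prim t n) (g_light_term t n x).
Proof.
have h a b := is_derive_mono_prim b a t x.
exact: (is_deriveD (is_deriveD (is_deriveD
  (is_deriveZ _ (is_deriveZ _ (h n n))) (is_deriveZ _ (h n.+1 n)))
  (is_deriveZ _ (is_deriveZ _ (h n.+2 n))))
  (is_deriveZ _ (is_deriveZ _ (h n n.+2)))).
Qed.

Lemma continuous_g_light_term t n : continuous (g_light_term t n).
Proof.
move=> x; have h a b := is_derive_mono a b t x.
have [d _] := (is_deriveD (is_deriveD (is_deriveD
  (is_deriveZ 2^-1 (is_deriveZ (odd_seq n) (h n n)))
  (is_deriveZ 2^-1 (h n.+1 n)))
  (is_deriveZ 4^-1 (is_deriveZ (odd_seq n) (h n.+2 n))))
  (is_deriveZ 4^-1 (is_deriveZ (odd_seq n) (h n n.+2)))).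
exact/differentiable_continuous/derivable1_diffP.
Qed.

Lemma g_light_term_ge0 t n x : `|x| <= t -> 0 <= g_light_term t n x.
Proof.
move=> xt; have h a b := mono_ge0 a b xt.
have o0 : 0 <= odd_seq n :> R by rewrite /odd_seq.
have nneg (o u v w z : R) : 0 <= o -> 0 <= u -> 0 <= v -> 0 <= w -> 0 <= z ->
    0 <= 2^-1 * (o * u) + 2^-1 * v + 4^-1 * (o * w) + 4^-1 * (o * z).
  by move=> *; rewrite !addr_ge0// !mulr_ge0.
exact: nneg.
Qed.

(** The factor 2 of each monomial integral cancels the weights 1/2; the two terms of weight 1/4 have
    the same degree 2n + 3 and merge. *)
Definition g_light_mass t n : R :=
  odd_seq n * dpow (2 * n + 1) t + dpow (2 * n + 2) t
  + odd_seq n * dpow (2 * n + 3) t.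

Lemma integral_g_light_term t n : 0 < t ->
  (\int[mu]_(x in `](- t)%R, t[) (g_light_term t n x)%:E = (g_light_mass t n)%:E)%E.
Proof.
move=> t0; have tt : - t < t by lra.
rewrite (integral_derivative tt (@continuous_g_light_term t n) (is_derive_g_light_term_prim t n)).
congr (_%:E); rewrite /g_light_term_prim !mono_prim_left !mono_prim_right /g_light_mass.
have -> : (n + n).+1 = (2 * n + 1)%N by lia.
have -> : (n.+1 + n).+1 = (2 * n + 2)%N by lia.
have -> : (n.+2 + n).+1 = (2 * n + 3)%N by lia.
have -> : (n + n.+2).+1 = (2 * n + 3)%N by lia.
by field.
Qed.

(** An even n contributes only degree 2n + 2, an odd n three consecutive degrees. The pair 2N, 2N +
    1 thus supplies degrees 4N + 2 to 4N + 5, each once; only degrees 0 and 1 are never reached. *)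
Lemma series_g_light_mass t N :
  series (g_light_mass t) (2 * N)%N = series (exp_coeff t) (4 * N + 2)%N - 1 - t.
Proof.
elim: N => [|N IH].
  rewrite !muln0 add0n /series/= big_nil !big_nat_recr//= big_nil /exp_coeff/=.
  by rewrite fact0 expr0 expr1 !divr1; ring.
have -> : (2 * N.+1 = (2 * N).+2)%N by lia.
have -> : (4 * N.+1 + 2 = (4 * N + 2).+4)%N by lia.
rewrite !seriesS IH /g_light_mass /odd_seq /= !oddM /= /exp_coeff /= -!/(dpow _ _).
have -> : (2 * (2 * N) + 2 = 4 * N + 2)%N by lia.
have -> : (2 * (2 * N).+1 + 1 = (4 * N + 2).+1)%N by lia.
have -> : (2 * (2 * N).+1 + 2 = (4 * N + 2).+2)%N by lia.
have -> : (2 * (2 * N).+1 + 3 = (4 * N + 2).+3)%N by lia.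
by rewrite /dpow; ring.
Qed.

Lemma g_light_mass_ge0 t n : 0 <= t -> 0 <= g_light_mass t n.
Proof.
move=> t0; have o0 : 0 <= odd_seq n :> R by rewrite /odd_seq.
have d0 k : 0 <= dpow k t := dpow_ge0 k t0.
by apply: addr_ge0; [apply: addr_ge0; [exact: mulr_ge0|]|exact: mulr_ge0].
Qed.

(** The closed form covers even cut-offs only. Nonnegativity makes the whole series converge, so
    this subsequence fixes its sum. *)
Lemma nneseries_g_light_mass t : 0 <= t ->
  (\sum_(n <oo) (g_light_mass t n)%:E = (expR t - 1 - t)%:E)%E.
Proof.
move=> t0.
have cv : cvgn (fun n => (\sum_(0 <= i < n) (g_light_mass t i)%:E)%E).
  by apply: is_cvg_nneseries => n _ _; rewrite lee_fin g_light_mass_ge0.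
have dbl (a b : nat) : (0 < a)%N -> (a * n + b)%N @[n --> \oo] --> \oo.
  move=> a0; apply/cvgnyPge => A; near=> n.
  have : (A <= n)%N by near: n; exact: nbhs_infty_ge.
  by nia.
have h1 := cvg_comp _ _ (dbl 2 0 isT) cv.
have h2 : (series (exp_coeff t) (4 * n + 2)%N - 1 - t)%:E @[n --> \oo] -->
    (expR t - 1 - t)%:E.
  apply: cvg_EFin; first by apply: nearW.
  apply: cvgB; last exact: cvg_cst.
  apply: cvgB; last exact: cvg_cst.
  exact: cvg_comp (dbl 4 2 isT) (is_cvg_series_exp_coeff t).
apply: (cvg_unique _ h1); first exact: ereal_hausdorff.
move: h2; apply: cvg_trans; apply: near_eq_cvg; near=> n => /=.
by rewrite sumEFin addn0 -series_g_light_mass.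
Unshelve. all: end_near. Qed.

Lemma clifford_series c a (x y : R) : subunit c ->
  series (fun n => c n * (dpow (n + a) x * dpow n y)) @ \oo -->
  lightwave c a x y.
Proof.
move=> c1; rewrite /lightwave.
have h : pseries (clifford_coeff c a) (x * y) @ \oo --> clifford c a (x * y).
  exact: is_cvg_clifford.
apply: cvg_trans (cvgMl_tmp (a := x ^+ a) h); apply: near_eq_cvg; near=> n.
rewrite /pseries /series/= mulr_sumr; apply: eq_bigr => i _.
rewrite /clifford_coeff /dpow exprMn exprD; field.
by rewrite !factr_neq0.
Unshelve. all: end_near. Qed.

Lemma series_g_light_term t x : series (fun n => g_light_term t n x) @ \oo --> g_light t x.
Proof.
set p := (t + x) / 2; set q := (t - x) / 2.
have odd1 := @subunit_odd R; have one1 := @subunit_one R.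
have h0 := clifford_series (a := 0) (x := p) (y := q) odd1.
have h1 := clifford_series (a := 1) (x := p) (y := q) one1.
have h2 := clifford_series (a := 2) (x := p) (y := q) odd1.
have h3 := clifford_series (a := 2) (x := q) (y := p) odd1.
rewrite /g_light.
apply: cvg_trans (cvgD (cvgD (cvgD (cvgMl_tmp (a := 2^-1) h0)
  (cvgMl_tmp (a := 2^-1) h1)) (cvgMl_tmp (a := 4^-1) h2))
  (cvgMl_tmp (a := 4^-1) h3)).
apply: near_eq_cvg; near=> n.
rewrite /series/= -[LHS]/(_ * _ + _ * _ + _ * _ + _ * _).
rewrite !mulr_sumr -!big_split; apply: eq_bigr => i _ /=.
rewrite /g_light_term /mono -/p -/q addn0 addn1 addn2 /one_seq; ring.
Unshelve. all: end_near. Qed.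

Lemma damped_g_light_nneseries t x :
  ((damped g_light t x)%:E = \sum_(n <oo) (expR (- t) * g_light_term t n x)%:E)%E.
Proof.
apply/esym/cvg_lim => //.
have h := cvgMl_tmp (a := expR (- t)) (series_g_light_term (t := t) (x := x)).
apply: (@cvg_trans _ ((fun n => (expR (- t) * series (g_light_term t ^~ x) n)%:E) @ \oo)).
  apply: near_eq_cvg; near=> n.
  by rewrite /series/= mulr_sumr sumEFin.
by apply: cvg_EFin; [exact: nearW|exact: h].
Unshelve. all: end_near. Qed.

(** The terms are nonnegative, so sum and integral may be exchanged; the result e^{-t}(e^t - 1 - t)
    is what the atom lacks to reach 1. *)
Lemma integral_f_c t : 0 <= t ->
  (\int[mu]_(x in `](- t)%R, t[) (f_c t x)%:E
   + (expR (- t) * (1 + t))%R%:E = 1)%E.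
Proof.
rewrite le_eqVlt => /predU1P[<-|t0].
  (* At t = 0 the interval is empty and the atom carries all the mass. *)
  by rewrite oppr0 set_itvoo0 integral_set0 expR0 mul1r addr0 add0e.
have inD x : `](- t)%R, t[%classic x -> `|x| < t.
  by rewrite /= in_itv/= ltr_norml.
have mgt n : measurable_fun `](- t)%R, t[%classic
    (fun x => (expR (- t) * g_light_term t n x)%:E).
  apply/measurable_EFinP; apply: measurable_funTS.
  apply: continuous_measurable_fun => x.
  by apply: cvgMl_tmp; exact: continuous_g_light_term.
transitivity (\int[mu]_(x in `](- t)%R, t[)
    (\sum_(n <oo) (expR (- t) * g_light_term t n x)%:E)
    + (expR (- t) * (1 + t))%R%:E)%E.
  congr (_ + _)%E; apply: eq_integral => x /set_mem /inD xt.
  by rewrite f_cE// damped_g_light_nneseries.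
rewrite integral_nneseries//; last first.
  move=> n x /inD xt; rewrite lee_fin mulr_ge0 ?expR_ge0//.
  exact/g_light_term_ge0/ltW.
have int_n n : (\int[mu]_(x in `](- t)%R, t[) (expR (- t) * g_light_term t n x)%:E
    = (expR (- t))%:E * (g_light_mass t n)%:E)%E.
  under eq_integral do rewrite EFinM.
  rewrite ge0_integralZl_EFin//.
  - by rewrite integral_g_light_term.
  - by move=> x /inD xt; rewrite lee_fin; exact/g_light_term_ge0/ltW.
  - apply/measurable_EFinP; apply: measurable_funTS.
    by apply: continuous_measurable_fun; exact: continuous_g_light_term.
rewrite (eq_eseriesr (fun n _ => int_n n)).
rewrite nneseriesZl; last by move=> n _; rewrite lee_fin g_light_mass_ge0// ltW.
rewrite nneseries_g_light_mass ?ltW// -EFinM -EFinD; congr (_%:E).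
have : expR (- t) * expR t = 1 by rewrite -expRD addNr expR0.
by move: (expR (- t)) (expR t) => u v uv; rewrite -uv; ring.
Qed.

Lemma f_dist_total t : 0 <= t -> f_dist t `[- t, t] = 1%E.
Proof.
move=> t0; rewrite -[RHS](integral_f_c t0) /f_dist; congr (_ + _)%E.
  congr (integral _ _ _); apply/setIidr => x /=; rewrite !in_itv/=.
  by move=> /andP[/ltW-> /ltW->].
rewrite diracE mem_set ?mule1//= in_itv/= lexx andbT; lra.
Qed.

End MassOfDensity.

(** * The random motion near the wave fronts *)

Section OccupationTimes.
Context {R : realType}.
Implicit Types (A B : set R) (a b t : R).
Let mu := @lebesgue_measure R.

(** For measurable [A] the default value of [fine] is never met, as [0, t] has finite measure. *)
Definition occupation A t : R := fine (mu (A `&` `[0, t])).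

Lemma occupation_fin A t : measurable A -> mu (A `&` `[0, t]) \is a fin_num.
Proof.
move=> mA; rewrite ge0_fin_numE//.
apply: (@le_lt_trans _ _ (mu `[0, t])).
  by apply: le_measure; rewrite ?inE//; exact: measurableI.
by rewrite /mu lebesgue_measure_itv/=; case: ifPn => // _; rewrite -EFinB ltry.
Qed.

Lemma occupation_ge_itv A a b t : measurable A -> 0 <= a -> a <= b -> b <= t ->
  `[a, b[%classic `<=` A -> b - a <= occupation A t.
Proof.
move=> mA a0; rewrite le_eqVlt => /predU1P[<-|ab] bt sA.
  by rewrite subrr fine_ge0.
rewrite -lee_fin fineK ?occupation_fin//.
have <- : mu `[a, b[%classic = (b - a)%:E.
  by rewrite /mu lebesgue_measure_itv/= lte_fin ab.
apply: le_measure; rewrite ?inE//; first exact: measurableI.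
move=> s /= sab; split; first exact: sA.
by move: sab; rewrite /= !in_itv/=; lra.
Qed.

Lemma occupation_disjoint A B t : measurable A -> measurable B -> A `&` B = set0 ->
  0 <= t -> occupation A t + occupation B t <= t.
Proof.
move=> mA mB AB t0; rewrite -lee_fin EFinD !fineK ?occupation_fin//.
rewrite -measureU.
- have tE : mu `[0, t] = t%:E.
    rewrite /mu lebesgue_measure_itv/= lte_fin; case: ltgtP t0 => // [t0 _|<- _].
      by rewrite oppr0 addr0.
    by [].
  rewrite -tE; apply: le_measure; rewrite ?inE//.
    by apply: measurableU; exact: measurableI.
  by move=> s [] [].
- exact: measurableI.
- exact: measurableI.
- by rewrite setIACA AB set0I.
Qed.

End OccupationTimes.

(** * The 2-Erlang law and its difference quotients *)

Section Erlang.
Context {R : realType}.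
Let mu := @lebesgue_measure R.

(** For s >= 0 this is minus the tail probability of the law. *)
Definition erlang2_prim (s : R) : R := - ((1 + s) * expR (- s)).

Lemma is_derive_erlang2_prim (s : R) :
  is_derive s 1 erlang2_prim (s * expR (- s)).
Proof.
have hE : is_derive s 1 (fun t => expR (- t)) (expR (- s) * -1).
  by apply: is_derive1_comp.
have hs : is_derive s 1 (cst 1 + id : R -> R) (0 + 1).
  exact: is_deriveD.
have := is_deriveN (is_deriveM hs hE).
move=> h; apply: (is_derive_eq h).
by rewrite !scale_mulE /= -[(cst 1 + id) s]/(1 + s); ring.
Qed.

(** The density vanishes for s <= 0, so only the positive part of [A] counts; this form treats
    half-lines and bounded intervals at once. *)
Lemma integral_erlang2 (A : set R) (a b : R) : measurable A -> a < b ->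
  (forall s, A s /\ 0 < s <-> a < s < b) ->
  (\int[mu]_(s in A) (erlang2_pdf s)%:E
   = (erlang2_prim b - erlang2_prim a)%:E)%E.
Proof.
move=> mA ab Aab.
have cf : continuous (fun s : R => s * expR (- s)).
  move=> s; apply: cvgM; first exact: cvg_id.
  apply: (@continuous_comp _ _ _ (-%R : R -> R) expR); last exact: continuous_expR.
  exact: oppr_continuous.
rewrite -(integral_derivative ab cf is_derive_erlang2_prim).
rewrite integral_mkcond [RHS]integral_mkcond; apply: eq_integral => s _.
rewrite !patchE /erlang2_pdf; case: ifPn => [/set_mem As|nAs].
  case: ifPn => s0; first by rewrite mem_set//= in_itv/=; apply/Aab.
  case: ifPn => // /set_mem /=; rewrite in_itv/= => /Aab[_].
  by rewrite (negbTE s0).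
case: ifPn => // /set_mem /=; rewrite in_itv/= => /Aab[As _].
by rewrite mem_set in nAs.
Qed.

(** This is the chain rule at eps = 0. A negative [k] is allowed, which handles intervals ending at
    [a]. *)
Lemma cvg_right_quotient (F : R -> R) (l a k : R) : is_derive a 1 F l ->
  (F (a + k * eps) - F a) / eps @[eps --> 0^'+] --> k * l.
Proof.
move=> dF.
have dh : is_derive (0 : R) 1 (fun e : R => a + k * e) k.
  have h := is_deriveD (is_derive_cst a (0 : R) 1)
    (is_deriveZ k (is_derive_id (0 : R) 1)).
  by apply: (is_derive_eq h); rewrite add0r -[LHS]/(_ * _) mulr1.
have dF' : is_derive (a + k * 0) 1 F l by rewrite mulr0 addr0.
have [d dE] := @is_derive1_comp _ F (fun e => a + k * e) 0 l k dF' dh.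
rewrite mulrC -dE; apply: cvg_dnbhs_at_right.
apply: cvg_trans d; apply: near_eq_cvg; near=> e => /=.
by rewrite -[LHS]/(_ * _) mulr0 !addr0 [e%:A]mulr1 mulrC.
Unshelve. all: end_near. Qed.

End Erlang.

(** * Occupation times of the motion and the probabilities near the fronts *)

Section RandomMotion.
Context {R : realType} {d : measure_display} {Omega : measurableType d}.
Variables (P : probability Omega R) (theta : nat -> {RV P >-> R}).
Let mu := @lebesgue_measure R.
Let T := switch_time theta.

Definition fwd_times (w : Omega) : set R :=
  \bigcup_k `[T (2 * k)%N w, T (2 * k + 1)%N w[%classic.

Definition bwd_times (w : Omega) : set R :=
  \bigcup_k `[T (2 * k + 1)%N w, T (2 * k + 2)%N w[%classic.

Lemma measurable_fwd_times w : measurable (fwd_times w).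
Proof. by apply: bigcup_measurable => k _; exact: measurable_itv. Qed.

Lemma measurable_bwd_times w : measurable (bwd_times w).
Proof. by apply: bigcup_measurable => k _; exact: measurable_itv. Qed.

Lemma position_occupation t w :
  position theta t w = occupation (fwd_times w) t - occupation (bwd_times w) t.
Proof.
have int A : measurable A -> mu.-integrable `[0, t] (EFin \o \1_A).
  move=> mA; apply: measurable_bounded_integrable => //.
  - by have := occupation_fin t measurableT; rewrite setTI ge0_fin_numE.
  - exists 1; split => // M M1 s _ /=.
    by rewrite (le_trans _ (ltW M1))// indicE; case: (_ \in _);
       rewrite ?normr1 ?normr0.
have hF := int _ (measurable_fwd_times w).
have hB := int _ (measurable_bwd_times w).
have mF := measurable_fwd_times w; have mB := measurable_bwd_times w.
rewrite /position /velocity RintegralB//.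
by rewrite /Rintegral !integral_indic.
Qed.

Lemma measurable_switch_time n : measurable_fun setT (T n).
Proof. by rewrite /T /switch_time; apply: measurable_sum => i. Qed.

(** The random set of times is the section at [w] of a measurable subset of the product, and the
    measure of a section is measurable in [w]. *)
Lemma measurable_occupation_itvs (f g : nat -> Omega -> R) t :
  (forall k, measurable_fun setT (f k)) ->
  (forall k, measurable_fun setT (g k)) ->
  measurable_fun setT
    (fun w => occupation (\bigcup_k `[f k w, g k w[%classic) t).
Proof.
move=> mf mg.
(* The bounds f <= s < g become sign conditions on differences, hence preimages of fixed
   intervals. *)
pose A : set (Omega * R) :=
  (\bigcup_k ((fun z => z.2 - f k z.1) @^-1` `[0, +oo[
              `&` (fun z => g k z.1 - z.2) @^-1` `]0, +oo[))
  `&` (snd @^-1` `[0, t]).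
have mA : measurable A.
  have mpre (h : Omega * R -> R) (S : set R) : measurable_fun setT h ->
      measurable S -> measurable (h @^-1` S).
    by move=> mh mS; rewrite -[_ @^-1` _]setTI; exact: mh.
  apply: measurableI; last by apply: mpre => //; exact: measurable_snd.
  apply: bigcup_measurable => k _; apply: measurableI; apply: mpre => //.
  - by apply: measurable_funB => //; apply: measurableT_comp.
  - by apply: measurable_funB => //; apply: measurableT_comp.
have -> : (fun w => occupation (\bigcup_k `[f k w, g k w[%classic) t) =
    fine \o (mu \o xsection A).
  apply/funext => w; rewrite /occupation /=; congr (fine (mu _)).
  apply/seteqP; split => s /=.
    move=> [[k _ fg] st]; rewrite /xsection/=; apply: mem_set; split => //.
    exists k => //; split; move: fg; rewrite /= !in_itv/= andbT; lra.
  rewrite /xsection/= => /set_mem[[k _ [/= fs sg]] st]; split => //.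
  exists k => //=; move: fs sg; rewrite /= !in_itv/= !andbT; lra.
apply: measurableT_comp; first exact: fine_measurable.
exact: measurable_fun_xsection.
Qed.

Lemma measurable_position t : measurable_fun setT (position theta t).
Proof.
have -> : position theta t =
    (fun w => occupation (fwd_times w) t - occupation (bwd_times w) t).
  by apply/funext => w; exact: position_occupation.
by apply: measurable_funB; apply: measurable_occupation_itvs => k;
  exact: measurable_switch_time.
Qed.

Lemma switch_time1 w : T 1 w = theta 0%N w.
Proof. by rewrite /T /switch_time big_ord1. Qed.

Lemma switch_time2 w : T 2 w = theta 0%N w + theta 1%N w.
Proof. by rewrite /T /switch_time big_ord_recr/= big_ord1. Qed.

Lemma switch_time_nd w : (forall i, 0 <= theta i w) ->
  {homo T ^~ w : m n / (m <= n)%N >-> m <= n}.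
Proof.
move=> th0 m n; elim: n => [|n IH]; first by rewrite leqn0 => /eqP ->.
rewrite leq_eqVlt => /predU1P[->//|/IH h]; rewrite (le_trans h)//.
by rewrite /T /switch_time big_ord_recr /= lerDl.
Qed.

(** Only the first two sojourns are estimated individually; all later motion enters through the
    bound [t] on the total. *)
Lemma occupation_fwd_bwd t w : 0 < t -> (forall i, 0 <= theta i w) ->
  [/\ theta 0%N w <= t -> theta 0%N w <= occupation (fwd_times w) t,
      t <= theta 0%N w -> t <= occupation (fwd_times w) t,
      occupation (fwd_times w) t + occupation (bwd_times w) t <= t,
      theta 0%N w + theta 1%N w <= t -> theta 1%N w <= occupation (bwd_times w) t &
      theta 0%N w <= t -> t <= theta 0%N w + theta 1%N w ->
        t - theta 0%N w <= occupation (bwd_times w) t].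
Proof.
move=> t0 th0; have h0 := th0 0%N; have h1 := th0 1%N.
have Tnd := switch_time_nd th0.
have T0 : T 0 w = 0 by rewrite /T /switch_time big_ord0.
have fwdI b : b <= theta 0%N w -> `[0, b[%classic `<=` fwd_times w.
  move=> b0 s /=; rewrite in_itv/= => /andP[s0 sb]; exists 0%N => //=.
  by rewrite muln0 add0n in_itv/= switch_time1 T0 s0 (lt_le_trans sb).
have bwdI b : b <= theta 0%N w + theta 1%N w ->
    `[theta 0%N w, b[%classic `<=` bwd_times w.
  move=> b0 s /=; rewrite in_itv/= => /andP[s0 sb]; exists 0%N => //=.
  by rewrite muln0 !add0n in_itv/= switch_time1 switch_time2 s0 (lt_le_trans sb).
have mF := measurable_fwd_times w; have mB := measurable_bwd_times w.
split.
- move=> ht; rewrite -[leLHS]subr0; apply: occupation_ge_itv => //; exact: fwdI.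
- move=> ht; rewrite -[leLHS]subr0; apply: occupation_ge_itv => //; last exact: fwdI.
  exact: ltW.
- apply: occupation_disjoint => //; last exact: ltW.
  apply/seteqP; split => // s [] [k _ /=] + [j _ /=].
  rewrite !in_itv/= => /andP[ks sk] /andP[js sj].
  (* Whichever of the two sojourns comes first ends before the other starts, by monotonicity of the
     switching times. *)
  have [kj|jk] := leqP k j.
    have : (2 * k + 1 <= 2 * j + 1)%N by lia.
    by move=> /Tnd; lra.
  have : (2 * j + 2 <= 2 * k)%N by lia.
  by move=> /Tnd; lra.
- move=> ht; have -> : theta 1%N w = theta 0%N w + theta 1%N w - theta 0%N w.
    by ring.
  by apply: occupation_ge_itv => //; [rewrite lerDl|exact: bwdI].
- by move=> ht ht'; apply: occupation_ge_itv => //; exact: bwdI.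
Qed.

Hypothesis erlang : forall i, erlang2_distributed (theta i).

(** An exceptional null set; off it the switching times are nondecreasing. *)
Let nonpos := \bigcup_i (theta i @^-1` `]-oo, 0[%classic).

Lemma measurable_preimage i (A : set R) : measurable A ->
  measurable (theta i @^-1` A).
Proof. by move=> mA; rewrite -[_ @^-1` _]setTI; exact: measurable_funP. Qed.

Lemma probability_preimage i (A : set R) : measurable A ->
  P (theta i @^-1` A) = (\int[mu]_(s in A) (erlang2_pdf s)%:E)%E.
Proof. exact: erlang. Qed.

Lemma measurable_nonpos : measurable nonpos.
Proof. by apply: bigcup_measurable => i _; exact: measurable_preimage. Qed.

Lemma probability_nonpos : P nonpos = 0%E.
Proof.
apply/negligibleP; first exact: measurable_nonpos.
apply: negligible_bigcup => i; apply/negligibleP.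
  exact: measurable_preimage.
apply: (etrans (probability_preimage i _)) => //.
apply: integral0_eq => s /=.
by rewrite in_itv/= /erlang2_pdf => s0; rewrite ltNge (ltW s0).
Qed.

Lemma not_nonpos w : ~ nonpos w -> forall i, 0 <= theta i w.
Proof.
move=> nw i; rewrite leNgt; apply/negP => ti; apply: nw; exists i => //=.
Qed.

Lemma probability_small i (e : R) : 0 < e ->
  P (theta i @^-1` `]-oo, e[) = (erlang2_prim e - erlang2_prim 0)%:E.
Proof.
move=> e0; rewrite probability_preimage//; apply: integral_erlang2 => //.
by move=> s /=; rewrite in_itv/=; split => [[-> ->]|/andP[-> ->]].
Qed.

Lemma probability_near i (a b : R) : 0 <= a -> a < b ->
  P (theta i @^-1` `]a, b[) = (erlang2_prim b - erlang2_prim a)%:E.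
Proof.
move=> a0 ab; rewrite probability_preimage//; apply: integral_erlang2 => //.
move=> s /=; rewrite in_itv/=; split => [[]//|/andP[as_ sb]].
by rewrite as_ sb (le_lt_trans a0).
Qed.

(** The Erlang density vanishes at 0, so a sojourn shorter than eps/2 has probability o(eps). *)
Lemma small_quotient_cvg0 :
  (erlang2_prim (2^-1 * eps) - erlang2_prim 0) / eps @[eps --> (0 : R)^'+]
    --> (0 : R).
Proof.
have := @cvg_right_quotient R _ _ 0 2^-1 (is_derive_erlang2_prim 0).
rewrite mul0r mulr0; apply: cvg_trans; apply: near_eq_cvg; near=> e.
by rewrite add0r.
Unshelve. all: end_near.
Qed.

Lemma fine_probability_le (A : set Omega) (r : R) : measurable A -> (P A <= r%:E)%E ->
  fine (P A) <= r.
Proof. by move=> mA; rewrite -{1}(fineK (fin_num_measure P _ mA)) lee_fin. Qed.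

Let near_right t e := [set w | 0 < t - position theta t w < e].
Let near_left t e := [set w | t + position theta t w < e].

Lemma measurable_near_right t e : measurable (near_right t e).
Proof.
have mp : measurable_fun setT (fun w => t - position theta t w).
  by apply: measurable_funB => //; exact: measurable_position.
have := mp measurableT _ (measurable_itv `]0, e[); rewrite setTI.
by congr measurable; apply/seteqP; split => w /=; rewrite in_itv.
Qed.

Lemma measurable_near_left t e : measurable (near_left t e).
Proof.
have mp : measurable_fun setT (fun w => t + position theta t w).
  by apply: measurable_funD => //; exact: measurable_position.
have := mp measurableT _ (measurable_itv `]-oo, e[); rewrite setTI.
by congr measurable; apply/seteqP; split => w /=; rewrite in_itv.
Qed.

(** Let F and B be the forward and backward times. From F + B <= t follows t + x(t) >= 2F, and F is
    at least the minimum of [theta 0] and t, so the event forces [theta 0] below e/2. *)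
Lemma probability_near_left t e : 0 < t -> 0 < e -> e <= 2 * t ->
  fine (P (near_left t e)) <= erlang2_prim (2^-1 * e) - erlang2_prim 0.
Proof.
move=> t0 e0 et; have mE := measurable_near_left t e.
have e20 : 0 < 2^-1 * e by lra.
apply: fine_probability_le => //; rewrite -(probability_small 0 e20) -[leRHS]adde0.
rewrite -probability_nonpos.
have mS := measurable_preimage 0 (measurable_itv `]-oo, 2^-1 * e[).
have mN := measurable_nonpos.
apply: le_trans (measureU2 P mS mN); apply: le_measure; rewrite ?inE//.
  exact: measurableU.
move=> w /= wE; have [wN|wN] := pselect (nonpos w); [by right|left].
have th0 := not_nonpos wN.
have [h1 h2 h3 _ _] := occupation_fwd_bwd t0 th0.
rewrite /= in_itv/= ltNge; apply/negP => te.
move: wE; rewrite /near_left/= position_occupation.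
by have [/h1|/ltW/h2] := leP (theta 0%N w) t; lra.
Qed.

(** With B the backward time, t - x(t) >= 2B, so B < e/2 on the event. If [theta 1] is at least e/2,
    the second sojourn must outlast t, whence t - theta_0 <= B < e/2. *)
Lemma probability_near_right_le t e : 0 < t -> 0 < e -> e <= 2 * t ->
  fine (P (near_right t e)) <=
    (erlang2_prim t - erlang2_prim (t - 2^-1 * e))
    + (erlang2_prim (2^-1 * e) - erlang2_prim 0).
Proof.
move=> t0 e0 et; have mE := measurable_near_right t e.
have e20 : 0 < 2^-1 * e by lra.
have te0 : 0 <= t - 2^-1 * e by lra.
have tet : t - 2^-1 * e < t by lra.
apply: fine_probability_le => //; rewrite EFinD -(probability_small 1 e20).
rewrite -(probability_near 0 te0 tet) -[leRHS]adde0 -probability_nonpos.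
have mD := measurable_preimage 0 (measurable_itv `]t - 2^-1 * e, t[).
have mS := measurable_preimage 1 (measurable_itv `]-oo, 2^-1 * e[).
have mN := measurable_nonpos.
apply: (@le_trans _ _ (P (theta 0%N @^-1` `](t - 2^-1 * e)%R, t[
    `|` theta 1%N @^-1` `]-oo, (2^-1 * e)%R[) + P nonpos)%E); last first.
  by apply: leeD => //; exact: measureU2.
apply: le_trans (measureU2 P (measurableU _ _ mD mS) mN).
apply: le_measure; rewrite ?inE//.
  by do 2 apply: measurableU => //.
move=> w /= wE; have [wN|wN] := pselect (nonpos w); [by right|left].
have th0 := not_nonpos wN.
have [h1 h2 h3 h4 h5] := occupation_fwd_bwd t0 th0.
move: wE; rewrite /near_right/= position_occupation => /andP[wE1 wE2].
have [te|te] := ltP (theta 1%N w) (2^-1 * e).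
  by right; rewrite /= in_itv.
left; rewrite /= in_itv/=.
(* A first sojourn lasting until t puts the particle exactly on the front, which the strict
   inequality 0 < t - x(t) excludes. *)
have [/h2|ht] := leP t (theta 0%N w).
  have : 0 <= occupation (bwd_times w) t by exact: fine_ge0.
  by lra.
have := h1 (ltW ht); have := h5 (ltW ht).
have [/h4|/ltW ht2] := leP (theta 0%N w + theta 1%N w) t; first by lra.
by move=> /(_ ht2); lra.
Qed.

(** If [theta 0] lies in ]t - e/2, t[ and [theta 1] is at least e/2, there is no second switch
    before t, and 0 < t - x(t) <= 2(t - theta_0) < e. *)
Lemma probability_near_right_ge t e : 0 < t -> 0 < e -> e <= 2 * t ->
  (erlang2_prim t - erlang2_prim (t - 2^-1 * e))
    - (erlang2_prim (2^-1 * e) - erlang2_prim 0)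
  <= fine (P (near_right t e)).
Proof.
move=> t0 e0 et; have mE := measurable_near_right t e.
have e20 : 0 < 2^-1 * e by lra.
have te0 : 0 <= t - 2^-1 * e by lra.
have tet : t - 2^-1 * e < t by lra.
rewrite lerBlDr -lee_fin [leRHS]EFinD fineK ?fin_num_measure//.
rewrite -(probability_small 1 e20) -(probability_near 0 te0 tet).
rewrite -[leRHS]adde0 -probability_nonpos.
have mD := measurable_preimage 0 (measurable_itv `]t - 2^-1 * e, t[).
have mS := measurable_preimage 1 (measurable_itv `]-oo, 2^-1 * e[).
have mN := measurable_nonpos.
apply: (@le_trans _ _ (P (near_right t e
    `|` theta 1%N @^-1` `]-oo, (2^-1 * e)%R[) + P nonpos)%E); last first.
  by apply: leeD => //; exact: measureU2.
apply: le_trans (measureU2 P (measurableU _ _ mE mS) mN).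
apply: le_measure; rewrite ?inE//.
  by do 2 apply: measurableU => //.
move=> w /=; rewrite in_itv/= => /andP[w1 w2].
have [wN|wN] := pselect (nonpos w); [by right|left].
have th0 := not_nonpos wN.
have [h1 _ h3 _ h5] := occupation_fwd_bwd t0 th0.
have [te|te] := ltP (theta 1%N w) (2^-1 * e).
  by right; rewrite /= in_itv.
left; rewrite /near_right /= position_occupation.
have := h1 (ltW w2); have ht2 : t <= theta 0%N w + theta 1%N w by lra.
by have := h5 (ltW w2) ht2; move=> *; apply/andP; split; lra.
Qed.

Lemma near_right_cvg t : 0 < t ->
  fine (P (near_right t eps)) / eps @[eps --> 0^'+] --> 2^-1 * t * expR (- t).
Proof.
move=> t0.
have main : (erlang2_prim t - erlang2_prim (t - 2^-1 * eps)) / eps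
    @[eps --> (0 : R)^'+] --> 2^-1 * t * expR (- t).
  (* The interval ends at [t], so the quotient is taken backwards with slope -1/2 and then
     negated. *)
  have h := cvg_right_quotient (k := - 2^-1) (is_derive_erlang2_prim t).
  have -> : 2^-1 * t * expR (- t) = - (- 2^-1 * (t * expR (- t))) by ring.
  apply: cvg_trans (cvgN h); apply: near_eq_cvg; near=> e => /=.
  by rewrite -[LHS]/(- _) -mulNr opprB mulNr.
have small := small_quotient_cvg0.
pose D (e : R) : R := (erlang2_prim t - erlang2_prim (t - 2^-1 * e)) / e.
pose S (e : R) : R := (erlang2_prim (2^-1 * e) - erlang2_prim 0) / e.
(* Both bounds differ from the main quotient [D] only by [S], the contribution of a short second
   sojourn, which tends to 0. *)
apply: (@squeeze_cvgr _ _ _ _ (fun e => D e - S e) (fun e => D e + S e)).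
- near=> e.
  have e0 : 0 < e by near: e; exact: nbhs_right_gt.
  have et : e <= 2 * t by near: e; apply: nbhs_right_le; lra.
  rewrite /D /S -mulrBl -mulrDl !ler_pM2r ?invr_gt0//.
  by rewrite probability_near_right_le// probability_near_right_ge.
- by rewrite -[X in _ --> X]subr0; exact: cvgB main small.
- by rewrite -[X in _ --> X]addr0; exact: cvgD main small.
Unshelve. all: end_near. Qed.

Lemma near_left_cvg t : 0 < t ->
  fine (P (near_left t eps)) / eps @[eps --> 0^'+] --> (0 : R).
Proof.
move=> t0; apply: (@squeeze_cvgr _ _ _ _ (cst 0)
  (fun e => (erlang2_prim (2^-1 * e) - erlang2_prim 0) / e)); last 2 first.
- exact: cvg_cst.
- exact: small_quotient_cvg0.
near=> e.
have e0 : 0 < e by near: e; exact: nbhs_right_gt.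
have et : e <= 2 * t by near: e; apply: nbhs_right_le; lra.
rewrite divr_ge0 ?(ltW e0)//=; last by rewrite fine_ge0.
by rewrite ler_pM2r ?invr_gt0// probability_near_left.
Unshelve. all: end_near. Qed.

End RandomMotion.

Theorem mainTheorem1 (R : realType) :
  (* (i) *)
  (has_partials_in_cone 4 (@f_c R) /\
   (forall t x : R, `|x| < t ->
      iter 2 op_minus (iter 2 op_plus f_c) t x - f_c t x = 0)) /\
  (* (ii) *)
  (forall t : R, 0 <= t ->
     f_dist t `[- t, t] = 1%E /\
     (\int[lebesgue_measure]_(x in `](- t)%R, t[) (f_c t x)%:E
      + (expR (- t) * (1 + t))%R%:E = 1)%E) /\
  (* (iii) *)
  (forall t : R, 0 < t ->
     (f_c t x @[x --> t^'-] --> 2^-1 * t * expR (- t)) /\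
     (f_c t x @[x --> (- t)^'+] --> (0 : R)) /\
     (forall (d : measure_display) (Omega : measurableType d)
        (P : probability Omega R) (theta : nat -> {RV P >-> R}),
        mutually_independent theta ->
        (forall i, erlang2_distributed (theta i)) ->
        (fine (P [set w | 0 < t - position theta t w < eps]) / eps
           @[eps --> 0^'+] --> 2^-1 * t * expR (- t)) /\
        (fine (P [set w | t + position theta t w < eps]) / eps
           @[eps --> 0^'+] --> (0 : R)))).
Proof.
split; [split|split].
- exact: f_c_has_partials.
- exact: f_c_pde.
- by move=> t t0; split; [exact: f_dist_total|exact: integral_f_c].
- move=> t t0; split; [exact: f_c_cvg_right|split; first exact: f_c_cvg_left].
  by move=> d Omega P theta _ erlang; split;
    [exact: near_right_cvg|exact: near_left_cvg].
Qed.
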